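(* Let $q=r^2$ where $r$ is an odd prime power, and let $q-1=e_1f_1=e_2f_2$ with positive integers $e_1,f_1,e_2,f_2$. Suppose there is an integer $l\geq 2$ with $e_1\equiv 2^l \pmod{2^{l+1}}$ and $2^l\mid e_2$. Suppose further that $2e_2\mid e_1(r+1)$ and $e_1\mid e_2(r-1)$. Let $D_1=\frac{e_1}{\gcd(e_1,e_2)}$, $D_2=\frac{e_2}{\gcd(e_1,e_2)}$, let $s,t$ be integers with $1\leq s\leq D_1$, $1\leq t\leq D_2$, and put $n_1=sf_1+tf_2$. Then: (1) if both $\frac{r+1}{2}\left(\frac{te_1}{e_2}+1\right)$ (i.e. the integer $\frac{te_1(r+1)}{2e_2}+\frac{r+1}{2}$) and $n_1$ are even, there exists a $q$-ary MDS self-dual code of length $n_1$; (2) if both $\frac{r+1}{2}\left(\frac{te_1}{e_2}+t\right)$ (i.e. the integer $\frac{te_1(r+1)}{2e_2}+\frac{t(r+1)}{2}$) and $\frac{(t-1)(r+1)}{2}$ are even, and $n_1$ is odd, there exists a $q$-ary MDS self-dual code of length $n_1+1$; (3) if $\frac{r+1}{2}\left(\frac{te_1}{e_2}+t\right)$, $\frac{(t-1)(r+1)}{2}$ and $n_1$ are all even, there exists a $q$-ary MDS self-dual code of length $n_1+2$.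
   Context: $\mathbb{F}_q$ denotes the finite field with $q$ elements. A linear code of length $n$ over $\mathbb{F}_q$ is a subspace of $\mathbb{F}_q^n$; an $[n,k,d]$ code has dimension $k$ and minimum Hamming distance $d$, and it is MDS if $d=n-k+1$. The (Euclidean) dual of a code $C$ is $C^\perp=\{x\in\mathbb{F}_q^n : \sum_i x_ic_i=0 \text{ for all } c\in C\}$; $C$ is self-dual if $C=C^\perp$. A $q$-ary MDS self-dual code of length $n$ is a linear code over $\mathbb{F}_q$ of length $n$ that is both MDS and self-dual. *)

(* Defs.v *)
From HB Require Import structures.
From mathcomp Require Import all_boot all_order all_algebra all_field.
Set Implicit Arguments. Unset Strict Implicit. Unset Printing Implicit Defensive.
Import GRing.Theory.
Local Open Scope ring_scope.

Definition hweight (F : fieldType) (n : nat) (x : 'rV[F]_n) : nat :=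
  #|[set i : 'I_n | x 0 i != 0]|.

Definition edot (F : fieldType) (n : nat) (x y : 'rV[F]_n) : F :=
  \sum_(i < n) x 0 i * y 0 i.

(* d is the minimum Hamming distance of C (= minimum weight of a nonzero
   codeword, C being linear) *)
Definition is_min_dist (F : fieldType) (n : nat) (C : {vspace 'rV[F]_n}) (d : nat) : Prop :=
  (exists2 c, c \in C & c != 0 /\ hweight c = d) /\
  (forall c, c \in C -> c != 0 -> (d <= hweight c)%N).

Definition is_MDS (F : fieldType) (n : nat) (C : {vspace 'rV[F]_n}) : Prop :=
  is_min_dist C (n - \dim C + 1)%N.

Definition is_self_dual (F : fieldType) (n : nat) (C : {vspace 'rV[F]_n}) : Prop :=
  forall x : 'rV[F]_n, x \in C <-> (forall c, c \in C -> edot x c = 0).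

Definition exists_MDS_self_dual (F : fieldType) (n : nat) : Prop :=
  exists C : {vspace 'rV[F]_n}, is_MDS C /\ is_self_dual C.

Definition odd_prime_power (r : nat) : Prop :=
  odd r /\ exists p k : nat, [/\ prime p, (0 < k)%N & r = (p ^ k)%N].

(* Main.v *)
Require Import Defs.
From HB Require Import structures.
From mathcomp Require Import all_boot all_order all_algebra all_field.
From mathcomp Require Import cyclic zify.

(* Let [g] be a primitive element of F, [H1] and [H2] the subgroups of orders
   [f1] and [f2]. Take [s] cosets of [H1], where [X^f1] takes the values
   [x_i = g^(e2 f1 i)], and [t] cosets of [H2], where [X^f2] takes the values
   [y_j = g^(e1 f2 (2j+1) / 2)]. The divisibility hypotheses put the [x_i] in the
   subfield of order [r] and make the [y_j] of norm one over it; the 2-adic ones make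
   the cosets disjoint. With [P = prod_i (X^f1 - x_i) * prod_j (X^f2 - y_j)], the
   derivative [P'(a)] at a root [a] is a product of squares and of differences [u - v]
   of norm-one elements, and [(u - v)^(r-1) u v = -1] gives their quadratic
   character. So [P'] has quadratic character [(-1)^(t(h+E))] on the first family
   of roots and [(-1)^((t-1)h)] on the second, with [h = (r+1)/2] and
   [E = e1(r+1)/(2 e2)]. A generalized Reed-Solomon code on [n] points, [n] even,
   can be scaled to be self-dual as soon as this character is constant; extended by
   the point at infinity, [n] odd, as soon as it is 1. In case (3) the point 0 is
   added to the set of roots. *)

Set Implicit Arguments.
Unset Strict Implicit.
Unset Printing Implicit Defensive.

Import GRing.Theory.
Local Open Scope ring_scope.

(** * Self-dual MDS codes from a generator matrix *)

Lemma hweightE (F : fieldType) n (x : 'rV[F]_n) :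
  hweight x = (n - #|[set i | x 0%R i == 0%R]|)%N.
Proof.
have := cardsC [set i | x 0%R i == 0%R]; rewrite card_ord => xC.
suff -> : hweight x = #|~: [set i | x 0%R i == 0%R]| by lia.
by apply: eq_card => i; rewrite !inE.
Qed.

(** [G *m G^T = 0] puts the row space inside its dual, and [n = 2k] makes the two dimensions equal.
    Codewords with fewer than [k] zeros have weight at least [k + 1], the Singleton value
    [n - k + 1]. *)
Lemma mds_self_dual_of_generator (F : fieldType) n k (G : 'M[F]_(k, n)) :
    n = k.*2 -> (0 < k)%N -> G *m G^T = 0 ->
    (forall u : 'rV_k, u != 0 -> (#|[set i | (u *m G)%R 0%R i == 0%R]| < k)%N) ->
  exists_MDS_self_dual F n.
Proof.
move=> nE k_gt0 GG0 Gz.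
have Ginj (u : 'rV_k) : u *m G = 0 -> u = 0.
  move=> uG0; apply/eqP; apply: contraT => /Gz; rewrite uG0.
  rewrite (eq_card (_ : _ =i predT)) ?card_ord; first lia.
  by move=> i; rewrite !inE mxE eqxx.
have Gfree : row_free G.
  rewrite -kermx_eq0; apply/rowV0P => u /sub_kermxP; exact: Ginj.
pose f : 'Hom('rV[F]_k, 'rV[F]_n) := linfun (mulmxr G).
have fE u : f u = u *m G by rewrite lfunE.
exists (limg f); split; last first.
  move=> x; split.
    case/memv_imgP=> u _ ->{x} c /memv_imgP[w _ ->].
    have : (f u *m (f w)^T) = 0.
      by rewrite !fE trmx_mul mulmxA -(mulmxA u) GG0 mulmx0 mul0mx.
    move/matrixP/(_ 0 0); rewrite !mxE => <-.
    by apply: eq_bigr => i _; rewrite mxE.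
  move=> xC.
  have xG : x *m G^T = 0.
    apply/rowP => j; rewrite !mxE -[RHS](xC (f (delta_mx 0 j))) ?memv_img ?memvf //.
    by rewrite fE -rowE; apply: eq_bigr => i _; rewrite !mxE.
  have /eqmxP eqG : (G == kermx G^T)%MS.
    rewrite -mxrank_leqif_eq; last by apply/sub_kermxP.
    by rewrite mxrank_ker mxrank_tr (eqP Gfree); apply/eqP; lia.
  have /submxP[u ->] : (x <= G)%MS by rewrite eqG; apply/sub_kermxP.
  by rewrite -fE memv_img ?memvf.
have dimC : \dim (limg f) = k.
  rewrite limg_dim_eq ?dimvf ?/dim /= ?mul1n //.
  apply/eqP; rewrite -subv0; apply/subvP => u; rewrite memv_cap => /andP[_].
  by rewrite memv_ker fE => /eqP/Ginj ->; rewrite mem0v.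
have wt c : c \in limg f -> c != 0 -> (k.+1 <= hweight c)%N.
  case/memv_imgP=> u _ ->; rewrite fE => c0; rewrite hweightE.
  have /Gz : u != 0 by apply: contraNneq c0 => ->; rewrite mul0mx.
  by rewrite ltn_subRL => zk; rewrite [X in (_ < X)%N]nE -addnn ltn_add2r.
have dE : (n - k + 1)%N = k.+1 by lia.
rewrite /is_MDS dimC dE; split=> //.
have le_kn : (k.-1 <= n)%N by lia.
(* Fewer columns than rows: some nonzero codeword vanishes on k-1 chosen positions. *)
pose H : 'M[F]_(k, k.-1) := colsub (widen_ord le_kn) G.
have : kermx H != 0.
  rewrite -mxrank_eq0 mxrank_ker subn_eq0 -ltnNge (leq_ltn_trans (rank_leq_col H)) //.
  by rewrite prednK.
case/rowV0Pn=> u /sub_kermxP uH u0.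
exists (f u); first by rewrite memv_img ?memvf.
have fu0 : f u != 0 by apply: contraNneq u0; rewrite fE => /Ginj ->.
split=> //; apply/eqP; rewrite eqn_leq; apply/andP; split;
  last by rewrite wt ?memv_img ?memvf.
rewrite hweightE -dE.
have : (#|[set widen_ord le_kn j | j : 'I_k.-1]| <= #|[set i | f u 0%R i == 0%R]|)%N.
  apply/subset_leq_card/subsetP => _ /imsetP[j _ ->]; rewrite inE fE.
  move/rowP/(_ j): uH; rewrite !mxE => uH; apply/eqP; rewrite -[RHS]uH.
  by apply: eq_bigr => i _; rewrite !mxE.
rewrite card_imset ?card_ord => [le_z|].
  by rewrite (_ : (n - k + 1 = n - k.-1)%N) ?leq_sub2l //; lia.
by move=> i j /(congr1 val) /= /val_inj.
Qed.

(** * Lagrange interpolation and the Gram matrix of a Reed-Solomon generator *)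

Section Interpolation.

Variables (F : fieldType) (n : nat) (a : 'I_n -> F).
Hypothesis a_inj : injective a.

Definition nodal_deriv (i : 'I_n) : F := \prod_(j < n | j != i) (a i - a j).

Lemma nodal_deriv_neq0 i : nodal_deriv i != 0.
Proof.
apply/prodf_neq0 => j ji; rewrite subr_eq0.
by apply: contra ji => /eqP/a_inj->.
Qed.

(* The leading coefficient of the Lagrange interpolant. *)
Lemma sum_div_nodal_deriv (h : {poly F}) : (size h <= n)%N ->
  \sum_(i < n) h.[a i] / nodal_deriv i = h`_n.-1.
Proof.
move=> sz_h.
pose Q i := \prod_(j < n | j != i) ('X - (a j)%:P).
have sz_Q i : size (Q i) = n.
  rewrite /Q -big_filter size_prod_XsubC size_filter.
  by rewrite -sum1_count sum1_card cardC1 card_ord prednK // (leq_ltn_trans _ (ltn_ord i)).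
have Q_lead i : (Q i)`_n.-1 = 1.
  by have /monicP := monic_prod_XsubC (index_enum 'I_n) (predC1 i) a;
     rewrite lead_coefE -/(Q i) sz_Q.
have Qa i j : (Q i).[a j] = if i == j then nodal_deriv i else 0.
  rewrite horner_prod; case: eqP => [<- | /eqP ij].
    by apply: eq_bigr => k _; rewrite hornerXsubC.
  by rewrite (bigD1 j) 1?eq_sym //= hornerXsubC subrr mul0r.
(* Both sides have degree below [n] and agree at the [n] points [a i]. *)
have {2}-> : h = \sum_(i < n) (h.[a i] / nodal_deriv i) *: Q i.
  apply/eqP; rewrite -subr_eq0; apply/eqP.
  apply: (@roots_geq_poly_eq0 _ _ (codom a)).
  - apply/allP => _ /codomP[i ->]; rewrite /root hornerD hornerN horner_sum.
    rewrite (bigD1 i) //= hornerZ Qa eqxx divfK ?nodal_deriv_neq0 //.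
    rewrite big1 ?addr0 ?subrr // => j ji.
    by rewrite hornerZ Qa (negPf ji) mulr0.
  - by rewrite map_inj_uniq ?enum_uniq.
  rewrite size_codom card_ord (leq_trans (size_polyD _ _)) // geq_max sz_h.
  rewrite size_polyN; apply: (big_ind (fun p : {poly F} => size p <= n)%N).
  - by rewrite size_poly0.
  - by move=> p q hp hq; rewrite (leq_trans (size_polyD _ _)) // geq_max hp.
  by move=> i _; rewrite (leq_trans (size_scale_leq _ _)) ?sz_Q.
by rewrite coef_sum; apply: eq_bigr => i _; rewrite coefZ Q_lead mulr1.
Qed.

Lemma card_roots_lt (h : {poly F}) : h != 0 ->
  (#|[set i | root h (a i)]| < size h)%N.
Proof.
move=> h0; rewrite cardE -(size_map a); apply: max_poly_roots => //.
  by apply/allP => x /mapP[i]; rewrite mem_enum inE => hi ->.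
by rewrite map_inj_uniq ?enum_uniq.
Qed.

Definition grs_mx k (v : 'I_n -> F) : 'M[F]_(k, n) :=
  \matrix_(j, i) (v i * a i ^+ j).

Lemma mul_grs_mx k (v : 'I_n -> F) (u : 'rV_k) i :
  (u *m grs_mx k v) 0 i = v i * (rVpoly u).[a i].
Proof.
rewrite mxE horner_poly mulr_sumr; apply: eq_bigr => j _.
by rewrite mxE valK mulrCA.
Qed.

(** The entry is [c] times the coefficient of [X^(n-1)] in [X^(i+j)]. The bound allows [2k = n + 1],
    the case of the extended code, where only the last diagonal entry survives. *)
Lemma grs_mx_gram k (v : 'I_n -> F) c i j : (k.*2 <= n.+1)%N ->
    (forall i, v i ^+ 2 = c / nodal_deriv i) ->
  (grs_mx k v *m (grs_mx k v)^T) i j = c *+ (i + j == n.-1)%N.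
Proof.
move=> kn vE; rewrite mxE.
have := @sum_div_nodal_deriv 'X^(i + j).
rewrite size_polyXn coefXn => S.
rewrite eq_sym -[RHS]mulr_natr -S; last by have := ltn_ord i; have := ltn_ord j; lia.
rewrite mulr_sumr; apply: eq_bigr => m _; rewrite !mxE hornerXn.
by rewrite mulrACA -expr2 vE exprD mulrAC -mulrA.
Qed.

End Interpolation.

(** * Self-dual generalized Reed-Solomon codes *)

(** In dimension [n/2] the exponents [i + j] stay below [n - 1], so the Gram matrix vanishes; the
    zeros of a codeword are roots of a polynomial of degree below [n/2]. *)
Lemma mds_self_dual_grs (F : fieldType) n (a v : 'I_n -> F) c :
    injective a -> (0 < n)%N -> ~~ odd n ->
    (forall i, v i != 0) -> (forall i, v i ^+ 2 = c / nodal_deriv a i) ->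
  exists_MDS_self_dual F n.
Proof.
move=> a_inj n_gt0 n_even v0 vE.
have nE : n = n./2.*2 by rewrite even_halfK.
apply: (@mds_self_dual_of_generator _ _ n./2 (grs_mx a n./2 v)) => //; first lia.
  apply/matrixP => i j; rewrite (@grs_mx_gram _ _ _ a_inj _ _ c) ?mxE; [|lia|done].
  have := ltn_ord i; have := ltn_ord j.
  by case: eqP; rewrite ?mulr0n //; lia.
move=> u u0; have pu0 : rVpoly u != 0.
  by apply: contra u0 => /eqP pu; rewrite -[u]rVpolyK pu linear0.
have szu : (size (rVpoly u) <= n./2)%N by apply: size_poly.
apply: leq_trans szu; rewrite (eq_card (_ : _ =i [set i | root (rVpoly u) (a i)])) ?card_roots_lt //.
by move=> i; rewrite !inE mul_grs_mx mulf_eq0 (negPf (v0 i)).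
Qed.

(* Generalized Reed-Solomon code extended by the point at infinity. *)
Lemma mds_self_dual_extended_grs (F : fieldType) n (a v : 'I_n -> F) :
    injective a -> odd n ->
    (forall i, v i != 0) -> (forall i, v i ^+ 2 = -1 / nodal_deriv a i) ->
  exists_MDS_self_dual F (n + 1).
Proof.
move=> a_inj n_odd v0 vE.
have [k nE] : exists k, n = k.*2.+1 by exists n./2; lia.
(* The column at infinity reads off the coefficient of [X^k]; its Gram contribution, 1 in the last
   corner, cancels the [-1] there. *)
pose E : 'cV[F]_k.+1 := \col_j (j == ord_max)%:R.
apply: (@mds_self_dual_of_generator _ _ k.+1 (row_mx (grs_mx a k.+1 v) E)) => //.
- lia.
- rewrite tr_row_mx mul_row_col; apply/matrixP => i j.
  rewrite mxE (@grs_mx_gram _ _ _ a_inj _ _ (-1)) //; last by lia.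
  rewrite !mxE big_ord1 !mxE nE /= -natrM mulnb.
  have -> : (i + j == k.*2)%N = (i == ord_max) && (j == ord_max).
    rewrite -!val_eqE /=; have := ltn_ord i; have := ltn_ord j; lia.
  by rewrite mulNrn addNr.
move=> u u0; set p := rVpoly u.
have p0 : p != 0 by apply: contra u0 => /eqP pu; rewrite -[u]rVpolyK -/p pu linear0.
have sz_p : (size p <= k.+1)%N by apply: size_poly.
have -> : #|[set i | (u *m row_mx (grs_mx a k.+1 v) E) 0%R i == 0%R]| =
    (#|[set i | root p (a i)]| + (p`_k == 0)%R)%N.
  rewrite -!sum1_card big_mkcond big_split_ord big_ord1 /=; congr (_ + _)%N.
    rewrite [RHS]big_mkcond; apply: eq_bigr => i _; rewrite !inE mul_mx_row row_mxEl mul_grs_mx mulf_eq0.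
    by rewrite (negPf (v0 i)).
  rewrite inE mul_mx_row row_mxEr mxE (bigD1 ord_max) //= !mxE eqxx mulr1.
  rewrite big1 ?addr0 => [|j /negPf jmax]; last by rewrite !mxE jmax mulr0.
  by rewrite -(coef_rVpoly_ord u ord_max) /=; case: eqP.
(* If the coordinate at infinity vanishes, the degree drops, which pays for the extra zero. *)
have := card_roots_lt a_inj p0; case: eqP => pk; rewrite ?addn0 => lt_p.
  rewrite addn1 ltnS (leq_trans lt_p) //.
  rewrite leq_eqVlt in sz_p; case/orP: sz_p => [/eqP sz_p|]; last by rewrite ltnS.
  by move: p0; rewrite -lead_coef_eq0 lead_coefE sz_p /= pk eqxx.
exact: leq_trans lt_p sz_p.
Qed.

(** * Split polynomials and squares in finite fields *)

Lemma deriv_prod_XsubC (F : fieldType) n (a : 'I_n -> F) i :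
  (\prod_(j < n) ('X - (a j)%:P))^`().[a i] = nodal_deriv a i.
Proof.
rewrite (bigD1 i) //= derivM derivXsubC mul1r hornerD hornerM hornerXsubC.
rewrite subrr mul0r addr0 horner_prod.
by apply: eq_bigr => j _; rewrite hornerXsubC.
Qed.

(** A root occurring twice is also a root of the derivative. *)
Lemma uniq_deriv_neq0 (F : fieldType) (rs : seq F) :
    (forall x, x \in rs -> (\prod_(z <- rs) ('X - z%:P))^`().[x] != 0) ->
  uniq rs.
Proof.
elim: rs => //= z rs IHrs dn0.
have dE x : (\prod_(y <- z :: rs) ('X - y%:P))^`().[x] =
    (\prod_(y <- rs) ('X - y%:P)).[x] + (x - z) * (\prod_(y <- rs) ('X - y%:P))^`().[x].
  by rewrite big_cons derivM derivXsubC mul1r hornerD hornerM hornerXsubC.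
apply/andP; split.
  have := dn0 z (mem_head _ _); rewrite dE subrr mul0r addr0.
  by apply: contra => zrs; rewrite -/(root _ _) root_prod_XsubC.
apply: IHrs => x xrs; have := dn0 x; rewrite inE xrs orbT => /(_ isT).
rewrite dE; have /rootP -> : root (\prod_(y <- rs) ('X - y%:P)) x.
  by rewrite root_prod_XsubC.
by rewrite add0r mulf_eq0 negb_or => /andP[].
Qed.

(** Repeated roots are allowed; distinctness is later deduced from the nonvanishing of the
    derivative. *)
Definition splits (F : fieldType) n (P : {poly F}) : Prop :=
  exists2 rs : seq F, size rs = n & P = \prod_(z <- rs) ('X - z%:P).

Lemma splits_mul (F : fieldType) n1 n2 (P1 P2 : {poly F}) :
  splits n1 P1 -> splits n2 P2 -> splits (n1 + n2) (P1 * P2).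
Proof.
move=> [rs1 <- ->] [rs2 <- ->]; exists (rs1 ++ rs2); first by rewrite size_cat.
by rewrite big_cat.
Qed.

Lemma splits_prod (F : fieldType) n s (P : 'I_s -> {poly F}) :
  (forall i, splits n (P i)) -> splits (s * n) (\prod_i P i).
Proof.
elim: s P => [|s IHs] P sP; first by exists [::]; rewrite // big_ord0 big_nil.
by rewrite big_ord_recl mulSn; apply: splits_mul => //; apply: IHs.
Qed.

Lemma splits_X (F : fieldType) : splits 1 ('X : {poly F}).
Proof. by exists [:: 0] => //; rewrite big_seq1 subr0. Qed.

(** [Y - c] divides [Y^e - c^e = Y^e - 1]; at [Y = X^f] this makes [X^f - c] a divisor of [X^q - X],
    the product of all [X - x]. *)
Lemma splits_Xn_subC (F : finFieldType) e f (c : F) :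
  (0 < f)%N -> #|F|.-1 = (e * f)%N -> c ^+ e = 1 -> splits f ('X^f - c%:P).
Proof.
move=> f_gt0 qE ce.
have : ('X^f - c%:P : {poly F}) %| \prod_x ('X - x%:P).
  rewrite -finField_genPoly -(prednK (ltnW (finNzRing_gt1 F))) exprS qE mulnC exprM.
  have -> : 'X * ('X^f) ^+ e - 'X = (('X^f) ^+ e - c%:P ^+ e) * 'X :> {poly F}.
    by rewrite -polyC_exp ce mulrBl mul1r mulrC.
  by rewrite subrXX -mulrA dvdp_mulIl.
case/dvdp_prod_XsubC => b; set rs := mask _ _ => eq_rs.
have PE : 'X^f - c%:P = \prod_(z <- rs) ('X - z%:P).
  apply/eqP; rewrite -eqp_monic //; last exact: monic_prod_XsubC.
  exact: monicXnsubC.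
exists rs => //; apply: succn_inj.
by rewrite -(size_prod_XsubC rs id) -PE size_XnsubC.
Qed.

Lemma finField_prim_root (F : finFieldType) :
  exists g : F, (#|F|.-1).-primitive_root g.
Proof.
have q_gt1 := finNzRing_gt1 F.
have /hasP[g _ g_prim] : has (#|F|.-1).-primitive_root (enum (predC1 (0 : F))).
  apply: has_prim_root; rewrite ?enum_uniq -?cardE ?cardC1 //.
  by rewrite -ltnS (prednK (ltnW q_gt1)).
  apply/allP => x; rewrite mem_enum inE => x0.
  apply/unity_rootP; apply: (mulfI x0).
  by rewrite -exprS prednK ?expf_card ?mulr1 // ltnW.
by exists g.
Qed.

(** Euler's criterion: for [u = g^k] with [g] primitive, [u^m = 1] forces [2m] to divide [k m], so
    [k] is even. *)
Lemma sqr_of_pow_half (F : finFieldType) m (u : F) :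
  #|F| = m.*2.+1 -> u ^+ m = 1 -> exists v, v ^+ 2 = u.
Proof.
move=> qE um; have [g g_prim] := finField_prim_root F.
have m_gt0 : (0 < m)%N by have := finNzRing_gt1 F; rewrite qE; lia.
have uq : u ^+ #|F|.-1 = 1 by rewrite qE /= -muln2 exprM um expr1n.
have [[k _] /= uE] := prim_rootP g_prim uq.
have : g ^+ (k * m) = 1 by rewrite exprM -uE um.
move/eqP; rewrite -(prim_order_dvd g_prim) qE /= -mul2n dvdn_pmul2r // => /dvdnP[j kE].
by exists (g ^+ j); rewrite -exprM -kE.
Qed.

(** * Codes from the quadratic character of a derivative *)

Section CodesFromPolynomials.

Variables (F : finFieldType) (m n : nat) (P : {poly F}).
Hypotheses (qE : #|F| = m.*2.+1) (P_splits : splits n P).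

Let m_gt0 : (0 < m)%N.
Proof. by have := finNzRing_gt1 F; rewrite qE; lia. Qed.

Lemma splits_evaluation_points (e : F) : e != 0 ->
    (forall x, root P x -> P^`().[x] ^+ m = e) ->
  exists2 a : 'I_n -> F, injective a & forall i, nodal_deriv a i ^+ m = e.
Proof.
move=> e0; case: P_splits => rs <- -> dE.
have rsE x : x \in rs -> (\prod_(z <- rs) ('X - z%:P))^`().[x] ^+ m = e.
  by move=> xrs; rewrite dE ?root_prod_XsubC.
have rs_uniq : uniq rs.
  apply: uniq_deriv_neq0 => x /rsE dx; apply: contra e0 => /eqP d0.
  by rewrite -dx d0 expr0n gtn_eqF.
exists (fun i => rs`_i) => [i j /eqP|i].
  by rewrite nth_uniq // => /eqP/val_inj.
rewrite -(rsE rs`_i) ?mem_nth // -deriv_prod_XsubC.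
by rewrite (big_nth 0) big_mkord.
Qed.

(** The values of the derivative share one quadratic character, so the quotient of any two is a
    square; one of them serves as the constant [c]. *)
Lemma mds_self_dual_of_roots (e : F) : e != 0 -> (0 < n)%N -> ~~ odd n ->
    (forall x, root P x -> P^`().[x] ^+ m = e) ->
  exists_MDS_self_dual F n.
Proof.
move=> e0 n_gt0 n_even /(splits_evaluation_points e0)[a a_inj aE].
have d0 := nodal_deriv_neq0 a_inj.
pose c := nodal_deriv a (Ordinal n_gt0).
have /fin_all_exists[v vE] i : exists v, v ^+ 2 = c / nodal_deriv a i.
  by apply: sqr_of_pow_half qE _; rewrite exprMn exprVn !aE divff.
apply: (mds_self_dual_grs a_inj n_gt0 n_even _ vE) => i.
by rewrite -sqrf_eq0 vE mulf_neq0 ?invr_neq0 ?d0.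
Qed.

(** The constant is now forced to be [-1], itself a square, so the values of the derivative have to
    be squares. *)
Lemma mds_self_dual_extended_of_roots : (-1) ^+ m = 1 :> F -> odd n ->
    (forall x, root P x -> P^`().[x] ^+ m = 1) ->
  exists_MDS_self_dual F (n + 1).
Proof.
move=> N1m n_odd /(splits_evaluation_points (oner_neq0 _))[a a_inj aE].
have d0 := nodal_deriv_neq0 a_inj.
have /fin_all_exists[v vE] i : exists v, v ^+ 2 = -1 / nodal_deriv a i.
  by apply: sqr_of_pow_half qE _; rewrite exprMn exprVn !aE invr1 mulr1.
apply: (mds_self_dual_extended_grs a_inj n_odd _ vE) => i.
by rewrite -sqrf_eq0 vE mulf_neq0 ?invr_neq0 ?oppr_eq0 ?oner_neq0 ?d0.
Qed.

End CodesFromPolynomials.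

(** * Derivatives of products of binomials *)

Lemma deriv_mul_root (F : fieldType) (p q : {poly F}) a :
  root p a -> (p * q)^`().[a] = p^`().[a] * q.[a].
Proof. by move=> /rootP pa; rewrite derivM hornerD !hornerM pa mul0r addr0. Qed.

Lemma horner_prod_Xn_subC (F : fieldType) s f (x : 'I_s -> F) (A : pred 'I_s) a :
  (\prod_(i < s | A i) ('X^f - (x i)%:P)).[a] = \prod_(i < s | A i) (a ^+ f - x i).
Proof. by rewrite horner_prod; apply: eq_bigr => i _; rewrite !hornerE. Qed.

Lemma root_prod_Xn_subCP (F : fieldType) s f (x : 'I_s -> F) a :
  reflect (exists i, a ^+ f = x i) (root (\prod_(i < s) ('X^f - (x i)%:P)) a).
Proof.
rewrite /root horner_prod_Xn_subC prodf_seq_eq0.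
apply: (iffP hasP) => [[i _ /= /eqP/subr0_eq]|[i ai]]; first by exists i.
by exists i; rewrite ?mem_index_enum //= ai subrr.
Qed.

Lemma deriv_prod_Xn_subC (F : fieldType) s f (x : 'I_s -> F) i a : a ^+ f = x i ->
  (\prod_(i < s) ('X^f - (x i)%:P))^`().[a] =
  a ^+ f.-1 *+ f * \prod_(j < s | j != i) (x i - x j).
Proof.
move=> ai; rewrite (bigD1 i) //= deriv_mul_root; last first.
  by rewrite /root !hornerE ai subrr.
by rewrite derivB derivXn derivC subr0 hornerMn hornerXn horner_prod_Xn_subC ai.
Qed.

(** * Quadratic character of the derivative on a union of cosets *)

Section CosetUnion.

Variables (F : finFieldType) (r h s t f1 f2 c1 c2 E : nat).
Variables (x : 'I_s -> F) (y : 'I_t -> F).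

(** This is [(q - 1)/2] for [q = r^2], so [u ^+ m] is the quadratic character of [u]. *)
Let m := (r.-1 * h)%N.
Let eps : F := (-1) ^+ E.
Let P1 := \prod_(i < s) ('X^f1 - (x i)%:P).
Let P2 := \prod_(j < t) ('X^f2 - (y j)%:P).

Hypotheses (rE : r.+1 = h.*2) (r_gt1 : (1 < r)%N) (r_pchar : [pchar F].-nat r).
Hypotheses (q0 : #|F|%:R = 0 :> F) (qE : #|F| = m.*2.+1).
Hypotheses (c1E : m = (c1 * f1)%N) (c2E : m = (c2 * f2)%N).
Hypotheses (x_inj : injective x) (xr : forall i, x i ^+ r = x i).
Hypothesis xc1 : forall i, x i ^+ c1 = 1.
Hypotheses (y_inj : injective y) (yh : forall j, y j ^+ h = eps).
Hypothesis yc2 : forall j, y j ^+ c2 = 1.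
Hypothesis root1_norm : forall a i, a ^+ f1 = x i -> (a ^+ f2) ^+ h = 1.
Hypothesis root2_real : forall b j, b ^+ f2 = y j -> (b ^+ f1) ^+ r = b ^+ f1.
Hypothesis disj : forall a i j, a ^+ f1 = x i -> a ^+ f2 = y j -> False.

(** As [m] is a multiple of [r - 1], elements of the subfield of order [r] are squares in [F]. *)
Lemma pow_half_subfield (u : F) : u ^+ r = u -> u != 0 -> u ^+ m = 1.
Proof.
move=> ur u0; have ur1 : u ^+ r.-1 = 1.
  by apply: (mulfI u0); rewrite -exprS prednK ?mulr1 // ltnW.
by rewrite exprM ur1 expr1n.
Qed.

Lemma subfield_sub (u v : F) : u ^+ r = u -> v ^+ r = v -> (u - v) ^+ r = u - v.
Proof. by move=> ur vr; rewrite exprDn_pchar // exprNn_pchar // ur vr. Qed.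

(* The Frobenius [u |-> u^r] inverts norm-one elements. *)
Lemma pow_half_norm_one_sub (u v : F) : u ^+ r.+1 = 1 -> v ^+ r.+1 = 1 -> u != v ->
  (u - v) ^+ m * (u ^+ h * v ^+ h) = (-1) ^+ h.
Proof.
rewrite !exprS => ur vr uv.
have uv_r : (u - v) ^+ r * (u * v) = v - u.
  rewrite exprDn_pchar // exprNn_pchar // mulrBl mulrA (mulrC _ u) ur mul1r.
  by rewrite (mulrC u) mulrA (mulrC _ v) vr mul1r.
rewrite exprM -!exprMn; congr (_ ^+ h).
have uv0 : u - v != 0 by rewrite subr_eq0.
by apply: (mulfI uv0); rewrite [LHS]mulrA -exprS prednK ?uv_r ?mulrN1 ?opprB // ltnW.
Qed.

Let eps2 : eps ^+ 2 = 1.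
Proof. exact: sqrr_sign. Qed.

Let y_norm j : y j ^+ r.+1 = 1.
Proof. by rewrite rE -muln2 exprM yh. Qed.

(** Integers are fixed by Frobenius, and [f] is nonzero in [F]: otherwise [q = 2cf + 1] would be 1
    there instead of 0. *)
Let pow_half_natr f c : m = (c * f)%N -> (f%:R : F) ^+ m = 1.
Proof.
move=> cE; apply: pow_half_subfield.
  by elim: (f) => [|k IHk]; rewrite ?expr0n ?gtn_eqF ?(ltnW r_gt1) // -natr1
    exprDn_pchar // IHk expr1n.
apply/eqP => f0; move: q0; rewrite qE cE -muln2 -natr1 !natrM f0 mulr0 mul0r add0r.
by move/eqP; rewrite oner_eq0.
Qed.

Let pow_half_root1 a i : a ^+ f1 = x i -> a ^+ m = 1.
Proof. by move=> ai; rewrite c1E mulnC exprM ai xc1. Qed.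

Let pow_half_root2 b j : b ^+ f2 = y j -> b ^+ m = 1.
Proof. by move=> bj; rewrite c2E mulnC exprM bj yc2. Qed.

Let pow_half_diff (u v e : F) : u ^+ r.+1 = 1 -> v ^+ r.+1 = 1 -> u != v ->
  u ^+ h * v ^+ h = e -> e ^+ 2 = 1 -> (u - v) ^+ m = (-1) ^+ h * e.
Proof.
move=> ur vr uv uve e2; have := pow_half_norm_one_sub ur vr uv; rewrite uve => <-.
by rewrite -mulrA -expr2 e2 mulr1.
Qed.

(** The factors [f1], [a^(f1-1)] and [x_i - x_j] are squares; each of the [t] factors [a^f2 - y_j]
    is a difference of norm-one elements and contributes [(-1)^h eps]. *)
Lemma pow_half_deriv1 a i : a ^+ f1 = x i ->
  (P1 * P2)^`().[a] ^+ m = ((-1) ^+ h * eps) ^+ t.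
Proof.
move=> ai; rewrite deriv_mul_root; last by apply/root_prod_Xn_subCP; exists i.
rewrite (deriv_prod_Xn_subC ai) horner_prod_Xn_subC -mulr_natr [LHS]exprMn [X in X * _]exprMn [X in X * _ * _]exprMn.
rewrite (pow_half_natr c1E) [_ ^+ f1.-1 ^+ _]exprAC (pow_half_root1 ai) expr1n !mul1r.
rewrite -!prodrXl big1 ?mul1r => [|j ji].
  have a1 := root1_norm ai.
  rewrite -[in RHS](card_ord t) -prodr_const; apply: eq_big => // j _.
  apply: pow_half_diff; rewrite ?y_norm ?a1 ?mul1r ?yh //.
    by rewrite rE -muln2 exprM a1 expr1n.
  by apply/eqP => aj; apply: (disj ai aj).
apply: pow_half_subfield; first exact: subfield_sub.
by rewrite subr_eq0 (inj_eq x_inj) eq_sym.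
Qed.

(** The factors [b^f1 - x_i] lie in the subfield, hence are squares; each of the [t - 1] differences
    [y_j - y_k] contributes [(-1)^h], since the two factors [eps] cancel. *)
Lemma pow_half_deriv2 b j : b ^+ f2 = y j ->
  (P1 * P2)^`().[b] ^+ m = ((-1) ^+ h) ^+ t.-1.
Proof.
move=> bj; rewrite mulrC deriv_mul_root; last by apply/root_prod_Xn_subCP; exists j.
rewrite (deriv_prod_Xn_subC bj) horner_prod_Xn_subC -mulr_natr [LHS]exprMn [X in X * _]exprMn [X in X * _ * _]exprMn.
rewrite (pow_half_natr c2E) [_ ^+ f2.-1 ^+ _]exprAC (pow_half_root2 bj) expr1n !mul1r.
rewrite -!prodrXl [X in _ * X]big1 ?mulr1 => [|i _].
  rewrite -[in RHS](card_ord t) -(cardC1 j) -prodr_const; apply: eq_big => // k kj.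
  rewrite (@pow_half_diff _ _ 1) ?y_norm ?mulr1 ?expr1n ?yh -?expr2 //.
  by rewrite (inj_eq y_inj) eq_sym.
apply: pow_half_subfield; first exact: subfield_sub (root2_real bj) (xr i).
by rewrite subr_eq0; apply/eqP => bi; apply: (disj bi bj).
Qed.

Lemma pow_half_root a : root (P1 * P2) a -> a ^+ m = 1.
Proof.
rewrite rootM => /orP[] /root_prod_Xn_subCP[i].
  exact: pow_half_root1.
exact: pow_half_root2.
Qed.

Let m_gt0 : (0 < m)%N.
Proof. by have := finNzRing_gt1 F; rewrite qE; lia. Qed.

Lemma splits_coset_union : splits (s * f1 + t * f2) (P1 * P2).
Proof.
have f1_gt0 : (0 < f1)%N by move: m_gt0; rewrite c1E muln_gt0 => /andP[].
have f2_gt0 : (0 < f2)%N by move: m_gt0; rewrite c2E muln_gt0 => /andP[].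
apply: splits_mul; apply: splits_prod => i.
  apply: (@splits_Xn_subC _ c1.*2); rewrite ?qE ?c1E -?doubleMl //=.
  by rewrite -muln2 exprM xc1 expr1n.
apply: (@splits_Xn_subC _ c2.*2); rewrite ?qE ?c2E -?doubleMl //=.
by rewrite -muln2 exprM yc2 expr1n.
Qed.

Lemma pow_half_N1 : (-1) ^+ m = 1 :> F.
Proof.
have r_odd : ~~ odd r.-1 by lia.
by rewrite -signr_odd oddM (negPf r_odd).
Qed.

(** At 0 the factors are [- x_i] and [- y_j], all squares. *)
Let pow_half_horner0 : (P1 * P2).[0] ^+ m = 1.
Proof.
have f1_gt0 : (0 < f1)%N by move: m_gt0; rewrite c1E muln_gt0 => /andP[].
have f2_gt0 : (0 < f2)%N by move: m_gt0; rewrite c2E muln_gt0 => /andP[].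
rewrite hornerM !horner_prod_Xn_subC exprMn -!prodrXl !big1 ?mulr1 // => i _;
  rewrite expr0n gtn_eqF // sub0r exprNn pow_half_N1 mul1r.
  by rewrite c2E exprM yc2 expr1n.
by rewrite c1E exprM xc1 expr1n.
Qed.

Let deriv1_exponent := (t * (h + E))%N.
Let deriv2_exponent := (t.-1 * h)%N.

Lemma pow_half_deriv a : root (P1 * P2) a ->
  (P1 * P2)^`().[a] ^+ m = (-1) ^+ deriv1_exponent \/
  (P1 * P2)^`().[a] ^+ m = (-1) ^+ deriv2_exponent.
Proof.
rewrite rootM => /orP[] /root_prod_Xn_subCP[i ai]; [left | right].
  by rewrite (pow_half_deriv1 ai) -exprD -exprM mulnC.
by rewrite (pow_half_deriv2 ai) -exprM mulnC.
Qed.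

Lemma mds_self_dual_coset_union (n := (s * f1 + t * f2)%N) : (0 < n)%N -> [/\
  odd deriv1_exponent = odd deriv2_exponent -> ~~ odd n -> exists_MDS_self_dual F n,
  ~~ odd deriv1_exponent -> ~~ odd deriv2_exponent -> odd n ->
    exists_MDS_self_dual F (n + 1) &
  ~~ odd deriv1_exponent -> ~~ odd deriv2_exponent -> ~~ odd n ->
    exists_MDS_self_dual F (n + 2)].
Proof.
move=> n_gt0.
have dE1 : ~~ odd deriv1_exponent -> ~~ odd deriv2_exponent ->
    forall a, root (P1 * P2) a -> (P1 * P2)^`().[a] ^+ m = 1.
  move=> odd1 odd2 a /pow_half_deriv.
  by rewrite -(signr_odd _ deriv1_exponent) -(signr_odd _ deriv2_exponent)
    (negPf odd1) (negPf odd2) => -[].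
split.
- move=> odd12 n_even.
  apply: (mds_self_dual_of_roots qE splits_coset_union
    (e := (-1) ^+ deriv1_exponent)) => //; first by rewrite signr_eq0.
  move=> a /pow_half_deriv.
  by rewrite -(signr_odd _ deriv1_exponent) -(signr_odd _ deriv2_exponent) odd12 => -[].
- move=> odd1 odd2 n_odd.
  exact: (mds_self_dual_extended_of_roots qE splits_coset_union pow_half_N1 n_odd (dE1 _ _)).
move=> odd1 odd2 n_even; rewrite -(addn1 1) addnA.
apply: (mds_self_dual_extended_of_roots qE (splits_mul splits_coset_union (splits_X F))
  pow_half_N1); first by rewrite addn1.
(* At an old root [a] the derivative gets multiplied by the square [a]; at the new root 0 it is the
   constant term of [P1 * P2], also a square. *)
move=> a; rewrite rootM rootX => /orP[Pa | /eqP->].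
  rewrite deriv_mul_root // hornerX exprMn (dE1 odd1 odd2 a Pa).
  by rewrite (pow_half_root Pa) mulr1.
by rewrite mulrC deriv_mul_root ?rootX // derivX hornerC mul1r pow_half_horner0.
Qed.

End CosetUnion.

(** * Powers of a primitive element and the choice of cosets *)

(** [g^(e' f)] has order [e / gcd(e, e')], so its powers with exponents below that order are
    distinct. *)
Lemma prim_expr_inj (R : nzRingType) (g : R) e e' f i j :
    (0 < f)%N -> (e * f).-primitive_root g ->
    (i < e %/ gcdn e e')%N -> (j < e %/ gcdn e e')%N ->
  g ^+ (e' * f * i) = g ^+ (e' * f * j) -> i = j.
Proof.
move=> f_gt0 /exp_prim_root/(_ (e' * f)%N); rewrite -muln_gcdl divnMr // gcdnC => g_prim.
move=> lti ltj; rewrite ![_ ^+ (_ * _ * _)%N]exprM => /eqP.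
by rewrite (eq_prim_root_expr g_prim) !modn_small // => /eqP.
Qed.

Lemma prim_root_half (R : idomainType) (g : R) m :
  (0 < m)%N -> m.*2.-primitive_root g -> g ^+ m = -1.
Proof.
move=> m_gt0 g_prim; have /eqP := prim_expr_order g_prim.
rewrite -muln2 exprM sqrf_eq1 -(prim_order_dvd g_prim) => /orP[/dvdn_leq|/eqP //].
by move=> /(_ m_gt0); lia.
Qed.

Local Close Scope ring_scope.

(* F is the field F_q, q = r^2; all finite fields of order q are isomorphic. *)
Theorem theorem2 (F : finFieldType) (r e1 f1 e2 f2 l s t : nat) :
  odd_prime_power r ->
  #|F| = r ^ 2 ->
  0 < e1 -> 0 < f1 -> 0 < e2 -> 0 < f2 ->
  r ^ 2 - 1 = e1 * f1 -> r ^ 2 - 1 = e2 * f2 ->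
  2 <= l ->
  e1 %% 2 ^ l.+1 = 2 ^ l ->
  2 ^ l %| e2 ->
  2 * e2 %| e1 * (r + 1) ->
  e1 %| e2 * (r - 1) ->
  1 <= s <= e1 %/ gcdn e1 e2 ->
  1 <= t <= e2 %/ gcdn e1 e2 ->
  [/\
    (~~ odd ((t * e1 * (r + 1)) %/ (2 * e2) + (r + 1) %/ 2) ->
     ~~ odd (s * f1 + t * f2) ->
     exists_MDS_self_dual F (s * f1 + t * f2)),
    (~~ odd ((t * e1 * (r + 1)) %/ (2 * e2) + t * (r + 1) %/ 2) ->
     ~~ odd ((t - 1) * (r + 1) %/ 2) ->
     odd (s * f1 + t * f2) ->
     exists_MDS_self_dual F (s * f1 + t * f2 + 1)) &
    (~~ odd ((t * e1 * (r + 1)) %/ (2 * e2) + t * (r + 1) %/ 2) ->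
     ~~ odd ((t - 1) * (r + 1) %/ 2) ->
     ~~ odd (s * f1 + t * f2) ->
     exists_MDS_self_dual F (s * f1 + t * f2 + 2))].
Proof.
case=> r_odd [p [k [p_pr k_gt0 rE]]] qE e1_gt0 f1_gt0 e2_gt0 f2_gt0 N1 N2 l_ge2.
move=> e1_mod /dvdnP[w e2E] /dvdnP[E e1E] /dvdnP[K e2K] /andP[s_gt0 s_le] /andP[t_gt0 t_le].
have [h rh] : exists h, r.+1 = h.*2 by exists (r.+1)./2; lia.
have r_gt1 : 1 < r by rewrite rE -{1}(exp1n k) ltn_exp2r // prime_gt1.
(* [e1 = 4 L u] and [e2 = 4 L w] with [u] odd; writing [2^l = 4 L] uses [2 <= l] and makes
   [e1/2 = 2 L u] even. *)
pose u := e1 %/ 2 ^ l; pose L := 2 ^ (l - 2).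
have pow_l : 2 ^ l = 4 * L by rewrite -(expnD 2 2) subnKC.
have L_gt0 : 0 < L by rewrite expn_gt0.
have e1u : e1 = u * (4 * L).
  rewrite -pow_l divnK // /dvdn -(modn_dvdm e1 (dvdn_exp2l 2 (leqnSn l))) e1_mod.
  by rewrite modnn.
have u_odd : odd u.
  move: e1_mod; rewrite e1u -pow_l expnSr mulnC -muln_modr -{2}(muln1 (2 ^ l)).
  by move/eqP; rewrite eqn_pmul2l ?expn_gt0 // modn2 eqb1.
rewrite pow_l in e2E.
have w_gt0 : 0 < w by move: e2_gt0; rewrite e2E muln_gt0 => /andP[].
have u_gt0 : 0 < u by case: (u) u_odd.
have r1E : r.-1 = h.-1 * 2 by clear -rh; lia.
pose m := r.-1 * h.
have NE : r ^ 2 - 1 = m.*2.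
  by rewrite /m doubleMr -rh -(exp1n 2) subn_sqr subn1 addn1.
have uf : u * f1 = w * f2.
  apply/eqP; rewrite -(eqn_pmul2r (_ : 0 < 4 * L)) ?muln_gt0 //.
  by rewrite mulnAC -e1u -N1 N2 e2E mulnAC.
have uh : u * h = w * E.
  apply/eqP; rewrite -(eqn_pmul2l (_ : 0 < 2 * (4 * L))) ?muln_gt0 //; apply/eqP.
  by move: e1E; rewrite e1u e2E addn1 rh; clear; lia.
have wK : w * r.-1 = u * K.
  apply/eqP; rewrite -(eqn_pmul2r (_ : 0 < 4 * L)) ?muln_gt0 //; apply/eqP.
  by move: e2K; rewrite e1u e2E subn1; clear; lia.
have mE1 : m = 2 * L * u * f1 by move: N1; rewrite NE e1u; clear; lia.
have mE2 : m = 2 * L * w * f2 by rewrite mE1 -mulnA uf mulnA.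
(* This identity and the next rewrite [(a^f2)^h] as [(a^f1)^E] and [(b^f1)^(r-1)] as [(b^f2)^K],
   linking the two families. *)
have fh : f2 * h = f1 * E.
  apply/eqP; rewrite -(eqn_pmul2l w_gt0) mulnA -uf mulnAC uh; apply/eqP.
  by clear; lia.
have fK : f1 * r.-1 = f2 * K.
  apply/eqP; rewrite -(eqn_pmul2l w_gt0) mulnCA wK mulnA (mulnC f1) uf; apply/eqP.
  by clear; lia.
have p_char : p \in [pchar F]%R.
  by apply: (@card_finPcharP _ p (k * 2)); rewrite // qE rE expnM.
have r_pchar : ([pchar F]%R).-nat r by rewrite rE pnatX pnatE // p_char.
have qm : #|F| = m.*2.+1 by rewrite -NE qE subn1 prednK // expn_gt0 (ltnW r_gt1).
have q0 : (#|F|%:R = 0 :> F)%R.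
  by rewrite qE rE -expnM natrX (pcharf0 p_char) expr0n gtn_eqF // muln_gt0 k_gt0.
have m_gt0 : 0 < m by rewrite mE1 !muln_gt0 L_gt0 u_gt0.
have [g] := finField_prim_root F; rewrite qm => g_prim.
have g1 a : (g ^+ (m.*2 * a) = 1)%R by rewrite exprM (prim_expr_order g_prim) expr1n.
have gm : (g ^+ m = -1)%R by apply: prim_root_half.
pose x (i : 'I_s) : F := (g ^+ (e2 * f1 * i))%R.
(* [2 * L * u] is [e1/2]; the odd multiplier [2j + 1] keeps this family apart from the first. *)
pose y (j : 'I_t) : F := (g ^+ (2 * L * u * f2 * (j.*2.+1)))%R.
have := @mds_self_dual_coset_union F r h s t f1 f2 (2 * L * u) (2 * L * w) E x y
  rh r_gt1 r_pchar q0 qm mE1 mE2.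
case.
- move=> i j xij; apply/val_inj.
  apply: (@prim_expr_inj _ g e1 e2 f1) => //; first by rewrite -N1 NE.
    exact: leq_trans (ltn_ord i) s_le.
  exact: leq_trans (ltn_ord j) s_le.
- move=> i; rewrite -[in LHS](prednK (ltnW r_gt1)) exprS -[RHS]mulr1; congr (_ * _)%R.
  rewrite -exprM -(g1 (i * K)); congr (_ ^+ _)%R.
  have := congr1 (muln (4 * L * f1 * i)) wK; rewrite mE1 e2E; clear; lia.
- move=> i; rewrite -exprM -(g1 (w * i * 2 * L)); congr (_ ^+ _)%R.
  by rewrite mE1 e2E; clear; lia.
- move=> i j yij; apply/val_inj.
  apply: (@prim_expr_inj _ g e2 e1 f2) => //; first by rewrite -N2 NE.
  + by rewrite gcdnC; exact: leq_trans (ltn_ord i) t_le.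
  + by rewrite gcdnC; exact: leq_trans (ltn_ord j) t_le.
  have g_neq0 : (g != 0)%R.
    by apply: contra_eq_neq (prim_expr_order g_prim) => ->;
      rewrite expr0n gtn_eqF ?double_gt0 // eq_sym oner_neq0.
  have yE a : (g ^+ (2 * L * u * f2 * a.*2.+1) =
      g ^+ (2 * L * u * f2) * g ^+ (e1 * f2 * a))%R.
    by rewrite -exprD e1u; congr (_ ^+ _)%R; clear; lia.
  by move: yij; rewrite /y !yE => /mulfI -> //; rewrite expf_neq0.
- move=> j; rewrite -exprM.
  have -> : 2 * L * u * f2 * j.*2.+1 * h = m * E * j.*2.+1.
    have := congr1 (muln (2 * L * f2 * j.*2.+1)) uh; rewrite mE2; clear; lia.
  by rewrite exprM exprM gm exprS -mul2n exprM sqrr_sign expr1n mulr1.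
(* [y_j^(e2/2)] is [g^m] raised to [(e1/2)(2j + 1)], and [e1/2] is even. *)
- move=> j; rewrite -exprM -(g1 (L * u * j.*2.+1)); congr (_ ^+ _)%R.
  by rewrite mE2; clear; lia.
- move=> a i ai; rewrite -exprM fh exprM ai -exprM -(g1 (i * h)); congr (_ ^+ _)%R.
  have := congr1 (muln (4 * L * f1 * i)) uh; rewrite mE1 e2E; clear; lia.
- move=> b j bj; rewrite -[in LHS](prednK (ltnW r_gt1)) exprS -[RHS]mulr1; congr (_ * _)%R.
  rewrite -exprM fK exprM bj -exprM -(g1 (h.-1 * j.*2.+1)); congr (_ ^+ _)%R.
  rewrite mE2; have := congr1 (muln (2 * L * f2 * j.*2.+1)) wK; rewrite r1E; clear; lia.
(* Since [u f1 = w f2], a common root gives [x_i^u = y_j^w]; but [x_i^u = 1], while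
   [y_j^w = (-1)^(u (2j+1)) = -1] as [u] is odd. *)
- move=> a i j ai aj; have : (a ^+ (f1 * u) = a ^+ (f2 * w))%R.
    by rewrite mulnC uf mulnC.
  rewrite 2!exprM ai aj -!exprM.
  have -> : e2 * f1 * i * u = m.*2 * (w * i) by rewrite mE1 e2E; clear; lia.
  have -> : 2 * L * u * f2 * j.*2.+1 * w = m * (u * j.*2.+1) by rewrite mE2; clear; lia.
  rewrite g1 exprM gm -signr_odd oddM u_odd /= odd_double expr1 => N1E.
  have := prim_order_dvd g_prim m; rewrite gm -N1E eqxx => /(dvdn_leq m_gt0).
  by clear -m_gt0; lia.
- by rewrite addn_gt0 !muln_gt0 s_gt0 f1_gt0.
have -> : (t * e1 * (r + 1)) %/ (2 * e2) = t * E.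
  by rewrite -mulnA e1E mulnA mulnK // muln_gt0.
rewrite (addn1 r) rh !divn2 -!doubleMr !doubleK subn1 -mulnDr (addnC E).
move=> case1 case2 case3; split=> [par1||].
(* Modulo 2, [t (h + E) - (t - 1) h] is [t E + h]: the hypothesis says exactly that the two
   characters agree. *)
- apply: case1; move: par1; rewrite -(prednK t_gt0) !oddM !oddD !oddM /=.
  by case: (odd t.-1); case: (odd E); case: (odd h).
- exact: case2.
exact: case3.
Qed.
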